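(* For every $n\ge 1$, the permutations of size $n$ sortable by $\mathbb{Q}_{\mathrm{cuts}}^{\prime}$ are exactly the $321$-avoiding separable permutations of size $n$; that is, $$S_n(\mathbb{Q}_{\mathrm{cuts}}^{\prime}) = Av_n(321,2413,3142).$$
   Context: Permutations are written in one-line notation; $S_n$ is the set of permutations of $[n]=\{1,\dots,n\}$, $id_n = 12\cdots n$, and $\varepsilon$ is the empty sequence. $Av_n(X)$ is the set of permutations in $S_n$ avoiding (in the classical pattern sense) every pattern in $X$; a permutation is separable if it avoids $2413$ and $3142$. The device $\mathbb{Q}_{\mathrm{cuts}}^{\prime}$ processes configurations $(s_{inp},s_{dev},s_{out})$ of three sequences (input, content of the device, output), starting from $(\pi,\varepsilon,\varepsilon)$ and ending at $(\varepsilon,\varepsilon,\pi')$, using freely chosen operations: push (move the first element of the input to the end of $s_{dev}$); pop (move the first element of $s_{dev}$ to the end of the output); cut/shuffle (if $s_{dev}=s_1\cdots s_m$ with $m\ge2$, choose $k\in\{2,\dots,m\}$ and replace the content by $s_k s_{k+1}\cdots s_m s_1\cdots s_{k-1}$), where immediately after each cut the entire content of the device must be unloaded, i.e. appended in order to the output, leaving the device empty. $S_n(\mathbb{Q}_{\mathrm{cuts}}^{\prime})$ is the set of $\pi\in S_n$ for which the final output $\pi'=id_n$ can be achieved. *)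

(* Defs.v *)
From Stdlib Require Import Relation_Operators.
From mathcomp Require Import all_boot.

Set Implicit Arguments.
Unset Strict Implicit.
Unset Printing Implicit Defensive.

(* Permutations of {1, ..., n} in one-line notation. *)
Definition is_perm (n : nat) (pi : seq nat) : bool := perm_eq pi (iota 1 n).

(* Intended for sequences with distinct entries. *)
Definition order_iso (s t : seq nat) : Prop :=
  size s = size t /\
  forall i j, i < size s -> j < size s ->
    (nth 0 s i < nth 0 s j) = (nth 0 t i < nth 0 t j).

Definition contains (pi tau : seq nat) : Prop :=
  exists2 s, subseq s pi & order_iso s tau.

Definition Av (n : nat) (X : seq (seq nat)) (pi : seq nat) : Prop :=
  is_perm n pi /\ forall tau, tau \in X -> ~ contains pi tau.

Record config := Config { inp : seq nat; dev : seq nat; out : seq nat }.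

(* [rot k.-1 d] is s_k ... s_m s_1 ... s_(k-1) for d = s_1 ... s_m.  Since a
   cut must be followed at once by unloading the whole device, the cut and the
   unloading form a single step. *)
Inductive step : config -> config -> Prop :=
| step_push x i d o :
    step (Config (x :: i) d o) (Config i (rcons d x) o)
| step_pop x i d o :
    step (Config i (x :: d) o) (Config i d (rcons o x))
| step_cut k i d o :
    2 <= k <= size d ->
    step (Config i d o) (Config i [::] (o ++ rot k.-1 d)).

Definition sortable (n : nat) (pi : seq nat) : Prop :=
  is_perm n pi /\
  clos_refl_trans config step
    (Config pi [::] [::]) (Config [::] [::] (iota 1 n)).

(* Main.v *)
Require Import Defs.
From Stdlib Require Import Relation_Operators Operators_Properties.
From mathcomp Require Import all_boot zify.

Set Implicit Arguments.
Unset Strict Implicit.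
Unset Printing Implicit Defensive.

(** The device is a queue, so without a cut it emits its input unchanged, and a
    cut emits a rotation of the current content.  Hence a complete run amounts
    to splitting the input into consecutive blocks and rotating each of them
    ([reachable_block_rotation]); popped entries are blocks of size one.  The
    output is increasing exactly when the input is a direct sum of blocks
    [a ++ c] such that [c ++ a] is increasing, that is, of skew sums of two
    increasing sequences.

    Such a direct sum avoids 321, 2413 and 3142.  These patterns are
    sum-indecomposable, so an occurrence lies inside a single block; and none of
    them is an increasing sequence followed by a lower increasing sequence
    ([sorted_rotation_avoids]).

    Conversely, let [x] be the first entry of a sequence avoiding the three
    patterns.  If no entry is below [x], then [x] alone is a block.  Otherwise
    let [y] be the first entry below [x], let [a] be what precedes [y], and let
    [c] be the longest run of entries below [x] that starts at [y].  Avoiding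
    321 makes [a] and [c] increasing, and an entry after [c] that is not above
    all of [a] creates one of the three patterns.  So [a ++ c] is a block, and the remainder is treated
    in the same way ([avoiding_first_block], [avoiding_sortable_blocks]). *)

(** * Runs of the device as rotations of consecutive blocks *)

Inductive block_rotation : seq nat -> seq nat -> Prop :=
| block_rotation_nil : block_rotation [::] [::]
| block_rotation_cat k b s t :
    block_rotation s t -> block_rotation (b ++ s) (rot k b ++ t).

Notation reachable := (clos_refl_trans config step).

Lemma reachable_push b i d o :
  reachable (Config (b ++ i) d o) (Config i (d ++ b) o).
Proof.
elim: b d => [|x b IH] d; first by rewrite cats0; apply: rt_refl.
apply: rt_trans (rt_step _ _ _ _ (step_push _ _ _ _)) _.
by rewrite -cat_rcons; apply: IH.
Qed.

Lemma reachable_pop d i o : reachable (Config i d o) (Config i [::] (o ++ d)).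
Proof.
elim: d o => [|x d IH] o; first by rewrite cats0; apply: rt_refl.
apply: rt_trans (rt_step _ _ _ _ (step_pop _ _ _ _)) _.
by rewrite -cat_rcons; apply: IH.
Qed.

(** Rotations by [0] or by at least the size of the block are trivial; they are
    not available as cuts, but popping the whole block has the same effect. *)
Lemma reachable_rot k b i o :
  reachable (Config (b ++ i) [::] o) (Config i [::] (o ++ rot k b)).
Proof.
apply: rt_trans (reachable_push _ _ _ _) _ => /=.
case: k => [|k]; first by rewrite rot0; apply: reachable_pop.
have [lekb|ltbk] := leqP (size b) k.+1.
  by rewrite rot_oversize //; apply: reachable_pop.
exact/rt_step/(@step_cut k.+2).
Qed.

(** Reading a run backwards from its end, the device content followed by the
    unread input is what remains to be cut into blocks: pushing does not change
    it, popping splits off a block of size one, and a cut splits off the content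
    of the device. *)
Lemma reachable_remainder c f :
  reachable c (Config [::] [::] f) ->
  exists2 t, f = out c ++ t & block_rotation (dev c ++ inp c) t.
Proof.
move/clos_rt_rt1n_iff; move Ee: (Config [::] [::] f) => e Hr.
elim: Hr Ee => [_ <-|c1 c2 c3 Hstep _ IH /IH [t -> Ht] {IH}].
  by exists [::]; [rewrite cats0 | constructor].
case: Hstep Ht => /= [x i d o|x i d o|k i d o _] Ht.
- by exists t; rewrite // -cat_rcons.
- by exists (x :: t); [rewrite cat_rcons | exact: (block_rotation_cat 0 [:: x])].
- by exists (rot k.-1 d ++ t); [rewrite catA | constructor].
Qed.

Lemma reachable_block_rotation s t :
  reachable (Config s [::] [::]) (Config [::] [::] t) <-> block_rotation s t.
Proof.
split=> [/reachable_remainder[_ /= -> //]|H].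
suff: forall o, reachable (Config s [::] o) (Config [::] [::] (o ++ t)) by apply.
elim: H => [|k b s' t' _ IH] o; first by rewrite cats0; apply: rt_refl.
by apply: rt_trans (reachable_rot k _ _ _) _; rewrite catA.
Qed.

Lemma block_rotation_perm s t : block_rotation s t -> perm_eq s t.
Proof.
by elim=> // k b s' t' _ IH; apply: perm_cat; rewrite // perm_sym perm_rot.
Qed.

(** * The three patterns, unfolded *)

Definition pattern321 (q : seq nat) :=
  if q is [:: x; y; z] then z < y < x else false.
Definition pattern2413 (q : seq nat) :=
  if q is [:: x; y; z; w] then [&& z < x, x < w & w < y] else false.
Definition pattern3142 (q : seq nat) :=
  if q is [:: x; y; z; w] then [&& y < w, w < x & x < z] else false.

Definition forbidden q := [|| pattern321 q, pattern2413 q | pattern3142 q].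

Definition avoiding s := forall q, subseq q s -> ~~ forbidden q.

Lemma order_iso321 q : order_iso q [:: 3; 2; 1] <-> pattern321 q.
Proof.
split; last first.
  case: q => [|x [|y [|z [|]]]] //= H.
  by split=> // -[|[|[|i]]] [|[|[|j]]] //= _ _; lia.
case=> Hs H; case: q Hs H => [|x [|y [|z [|]]]] //= _ H.
by have := H 2 1 isT isT; have := H 1 0 isT isT => /= -> ->.
Qed.

Lemma order_iso2413 q : order_iso q [:: 2; 4; 1; 3] <-> pattern2413 q.
Proof.
split; last first.
  case: q => [|x [|y [|z [|w [|]]]]] //= H.
  by split=> // -[|[|[|[|i]]]] [|[|[|[|j]]]] //= _ _; lia.
case=> Hs H; case: q Hs H => [|x [|y [|z [|w [|]]]]] //= _ H.
have := H 2 0 isT isT; have := H 0 3 isT isT; have := H 3 1 isT isT.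
by move=> /= -> -> ->.
Qed.

Lemma order_iso3142 q : order_iso q [:: 3; 1; 4; 2] <-> pattern3142 q.
Proof.
split; last first.
  case: q => [|x [|y [|z [|w [|]]]]] //= H.
  by split=> // -[|[|[|[|i]]]] [|[|[|[|j]]]] //= _ _; lia.
case=> Hs H; case: q Hs H => [|x [|y [|z [|w [|]]]]] //= _ H.
have := H 1 3 isT isT; have := H 3 0 isT isT; have := H 0 2 isT isT.
by move=> /= -> -> ->.
Qed.

Lemma Av_avoiding n s :
  Av n [:: [:: 3; 2; 1]; [:: 2; 4; 1; 3]; [:: 3; 1; 4; 2]] s <->
  is_perm n s /\ avoiding s.
Proof.
split=> -[Hperm H]; split=> //.
  move=> q Hq; apply/negP => /or3P[/order_iso321|/order_iso2413|/order_iso3142].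
  - by move=> Hi; case: (H [:: 3; 2; 1]) => //; exists q.
  - by move=> Hi; case: (H [:: 2; 4; 1; 3]) => //; exists q.
  - by move=> Hi; case: (H [:: 3; 1; 4; 2]) => //; exists q.
move=> tau; rewrite !inE => Htau [q Hq Hi]; move/negP: (H q Hq); apply.
apply/or3P; case/or3P: Htau => /eqP Etau; rewrite Etau in Hi.
- by constructor 1; apply/order_iso321.
- by constructor 2; apply/order_iso2413.
- by constructor 3; apply/order_iso3142.
Qed.

(** * Block rotations to increasing sequences avoid the patterns *)

Lemma subseq_cat_split (T : eqType) (q u v : seq T) :
  subseq q (u ++ v) ->
  exists q1 q2, [/\ q = q1 ++ q2, subseq q1 u & subseq q2 v].
Proof.
case/subseqP=> m Hm ->; rewrite size_cat in Hm.
exists (mask (take (size u) m) u), (mask (drop (size u) m) v).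
rewrite !mask_subseq -mask_cat ?cat_take_drop //.
by rewrite size_takel // Hm leq_addr.
Qed.

Lemma allrel_subseq (T S : eqType) (r : T -> S -> bool) u u' v v' :
  subseq u' u -> subseq v' v -> allrel r u v -> allrel r u' v'.
Proof.
move=> Hu Hv /allrelP H; apply/allrelP => x y Hx Hy.
by apply: H; [apply: (mem_subseq Hu) | apply: (mem_subseq Hv)].
Qed.

Lemma sorted_ltn_cat u v :
  sorted ltn (u ++ v) = [&& allrel ltn u v, sorted ltn u & sorted ltn v].
Proof. by rewrite !(sorted_pairwise ltn_trans) pairwise_cat. Qed.

Lemma forbidden_sum_indecomposable q1 q2 :
  allrel ltn q1 q2 -> forbidden (q1 ++ q2) -> q1 = [::] \/ q2 = [::].
Proof.
case: q1 => [|x1 q1]; first by left.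
case: q2 => [|y1 q2]; first by right.
rewrite /forbidden.
case: q1 => [|x2 [|x3 [|x4 [|x5 q1]]]]; case: q2 => [|y2 [|y3 [|y4 q2]]];
  rewrite /allrel //=; lia.
Qed.

Lemma forbidden_not_skew_sorted q1 q2 :
  sorted ltn q1 -> sorted ltn q2 -> allrel ltn q2 q1 -> ~~ forbidden (q1 ++ q2).
Proof.
rewrite /forbidden.
case: q1 => [|x1 [|x2 [|x3 [|x4 [|x5 q1]]]]];
  case: q2 => [|y1 [|y2 [|y3 [|y4 [|y5 q2]]]]];
  rewrite /allrel //=; lia.
Qed.

Lemma sorted_rotation_avoids k b : sorted ltn (rot k b) -> avoiding b.
Proof.
rewrite -{2}(cat_take_drop k b) /rot sorted_ltn_cat => /and3P[Hca Hc Ha] q.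
case/subseq_cat_split=> q1 [q2 [-> H1 H2]]; apply: forbidden_not_skew_sorted.
- exact: subseq_sorted ltn_trans _ _ H1 Ha.
- exact: subseq_sorted ltn_trans _ _ H2 Hc.
- exact: allrel_subseq H2 H1 Hca.
Qed.

(** An occurrence straddling [u] and [v] would split the pattern into a lower
    part followed by a higher one. *)
Lemma avoiding_sum u v :
  allrel ltn u v -> avoiding u -> avoiding v -> avoiding (u ++ v).
Proof.
move=> Huv Hu Hv q /subseq_cat_split[q1 [q2 [-> H1 H2]]].
apply/negP => Hq.
have [E|E] := forbidden_sum_indecomposable (allrel_subseq H1 H2 Huv) Hq.
  by move: Hq; rewrite E cat0s; apply/negP/Hv.
by move: Hq; rewrite E cats0; apply/negP/Hu.
Qed.

Lemma block_rotation_avoiding s t :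
  block_rotation s t -> sorted ltn t -> avoiding s.
Proof.
elim=> {s t} [_ q|k b s t Hst IH]; first by rewrite subseq0 => /eqP->.
rewrite sorted_ltn_cat => /and3P[Hbt Hb Ht]; apply: avoiding_sum.
- apply/allrelP => x y Hx Hy; move/allrelP: Hbt; apply.
    by rewrite mem_rot.
  by rewrite -(perm_mem (block_rotation_perm Hst)).
- exact: sorted_rotation_avoids Hb.
- exact: IH.
Qed.

(** * Sequences avoiding the patterns split into rotated blocks *)

Lemma takewhile_split (T : Type) (p : pred T) (s : seq T) :
  exists u v, [/\ s = u ++ v, all p u & if v is h :: _ then ~~ p h else true].
Proof.
elim: s => [|x s [u [v [-> Hu Hv]]]]; first by exists [::], [::].
case Hx: (p x); last by exists [::], (x :: u ++ v); rewrite Hx.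
by exists (x :: u), v; rewrite /= Hx.
Qed.

Lemma sorted_subseq2 (s : seq nat) :
  (forall u v, subseq [:: u; v] s -> u < v) -> sorted ltn s.
Proof.
rewrite (sorted_pairwise ltn_trans); elim: s => //= x s IH H.
apply/andP; split.
  by apply/allP => v Hv; apply: H; rewrite eqxx sub1seq.
apply: IH => u v Huv; apply: H; case: ifP => // _.
exact: subseq_trans (subseq_cons _ _) Huv.
Qed.

Lemma avoiding_suffix u v : avoiding (u ++ v) -> avoiding v.
Proof. by move=> H q Hq; apply/H/(subseq_trans Hq)/suffix_subseq. Qed.

(** The cut falls just before the first entry below the head of [s].  If there
    is none, [c] is empty and [a] is the head alone. *)
Lemma avoiding_first_block s :
  s != [::] -> uniq s -> avoiding s ->
  exists a c r, [/\ s = (a ++ c) ++ r, a ++ c != [::],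
                    sorted ltn (c ++ a) & allrel ltn (c ++ a) r].
Proof.
case: s => [//|x s] _ Us Hs.
have [a [v [Es Ha Hv]]] := takewhile_split (leq x) s.
case: v Es Hv => [Es _|y v Es].
  rewrite cats0 in Es; rewrite Es in Us *.
  exists [::x], [::], a; split=> //=.
  rewrite allrel1l; apply/allP => z Hz; rewrite /= ltn_neqAle (allP Ha) // andbT.
  by case/andP: Us => Hx _; apply: contraNneq Hx => ->.
rewrite -ltnNge => Hyx.
have [c [r [Ev Hc Hr]]] := takewhile_split (gtn x) v.
subst v s.
(* The block is [(x :: a) ++ (y :: c)]. *)
have Es : x :: a ++ y :: c ++ r = ((x :: a) ++ (y :: c)) ++ r.
  by rewrite /= -catA.
have Hneq p q : subseq [:: p; q] (x :: a ++ y :: c ++ r) -> p != q.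
  by move/subseq_uniq=> /(_ Us); rewrite /= inE andbT.
have Hxa z : z \in x :: a -> x <= z.
  by rewrite inE => /predU1P[->//|/(allP Ha)].
have Hyc z : z \in y :: c -> z < x.
  by rewrite inE => /predU1P[->//|/(allP Hc)].
(* In [x :: a], a descent followed by [y] would be a 321. *)
have Sa : sorted ltn (x :: a).
  apply: sorted_subseq2 => p q Hpq.
  have Hpqy : subseq [:: p; q; y] (x :: a ++ y :: c ++ r).
    rewrite -[_ :: _]/([:: p; q] ++ [:: y]) -(cat_cons x a).
    by apply: cat_subseq => //; rewrite sub1seq mem_head.
  have := Hs _ Hpqy; rewrite /forbidden /= !orbF.
  have Hq : q \in x :: a by apply: (mem_subseq Hpq); rewrite !inE eqxx orbT.
  have := Hneq p q (subseq_trans (prefix_subseq [:: p; q] [:: y]) Hpqy).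
  by have := Hxa _ Hq; lia.
(* In [y :: c], a descent preceded by [x] would be a 321. *)
have Sc : sorted ltn (y :: c).
  apply: sorted_subseq2 => p q Hpq.
  have Hxpq : subseq [:: x; p; q] (x :: a ++ y :: c ++ r).
    rewrite -[_ :: _]/([:: x] ++ [:: p; q]) Es.
    apply: subseq_trans (prefix_subseq _ _).
    by apply: cat_subseq; rewrite ?sub1seq ?mem_head.
  have := Hs _ Hxpq; rewrite /forbidden /= !orbF.
  have Hp : p \in y :: c by apply: (mem_subseq Hpq); rewrite mem_head.
  have := Hneq p q (subseq_trans (subseq_cons [:: p; q] x) Hxpq).
  by have := Hyc _ Hp; lia.
(* An entry [w] beyond the block and above [x] exceeds every [z] in
   [x :: a]: for [z] other than [x], otherwise [x z y w] would be a 2413. *)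
have Hrx w : w \in r -> x <= w -> forall z, z \in x :: a -> z < w.
  move=> Hw Hxw z Hz.
  have Hzyw : subseq ([:: z] ++ [:: y; w]) (x :: a ++ y :: c ++ r).
    rewrite -(cat_cons x a); apply: cat_subseq; first by rewrite sub1seq.
    by rewrite /= eqxx sub1seq mem_cat Hw orbT.
  have Hxw' : x != w.
    apply: Hneq; rewrite /= eqxx sub1seq mem_cat inE mem_cat Hw.
    by rewrite !orbT.
  have Hzw : z != w.
    apply: Hneq; apply: subseq_trans Hzyw.
    exact: (cat_subseq (subseq_refl [:: z]) (subseq_cons [:: w] y)).
  move: Hz; rewrite inE => /predU1P[Ezx|Hz]; first by lia.
  have Hxzyw : subseq ([:: x; z] ++ [:: y; w]) (x :: a ++ y :: c ++ r).
    rewrite -(cat_cons x a); apply: cat_subseq; first by rewrite /= eqxx sub1seq.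
    by rewrite /= eqxx sub1seq mem_cat Hw orbT.
  by have := Hs _ Hxzyw; rewrite /forbidden /=; lia.
(* The first entry [h] beyond the block is above [x] by maximality of [c]; a
   later [w] below [x] would complete [x y h w] to a 3142, or [x y w] to a 321. *)
have Hr_ge w : w \in r -> x <= w.
  case: r Us Hs Hr Es Hneq Hrx => // h r Us Hs Hh Es Hneq _.
  rewrite /= -leqNgt in Hh.
  rewrite inE => /predU1P[->//|Hw].
  have Hxyhw : subseq ([:: x] ++ [:: y] ++ [:: h; w])
                      (x :: a ++ y :: c ++ h :: r).
    rewrite -(cat_cons x a); apply: cat_subseq; first by rewrite sub1seq mem_head.
    rewrite -(cat_cons y c); apply: cat_subseq; first by rewrite sub1seq mem_head.
    by rewrite /= eqxx sub1seq.
  have Hxyw : subseq [:: x; y; w] [:: x; y; h; w].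
    exact: (cat_subseq (subseq_refl [:: x; y]) (subseq_cons [:: w] h)).
  have := Hs _ Hxyhw; have := Hs _ (subseq_trans Hxyw Hxyhw).
  have Hyw : y != w.
    apply: Hneq; apply: subseq_trans Hxyhw.
    by apply: subseq_trans Hxyw; apply: subseq_cons.
  have Hxh : x != h.
    apply: Hneq; apply: subseq_trans Hxyhw.
    apply: (@cat_subseq _ [:: x] [:: h] [:: x]); first exact: subseq_refl.
    by rewrite sub1seq !inE eqxx orbT.
  by rewrite /forbidden /=; lia.
exists (x :: a), (y :: c), r; split=> //.
- rewrite sorted_ltn_cat Sa Sc !andbT; apply/allrelP => p q /Hyc Hp /Hxa.
  exact: leq_trans.
- apply/allrelP => p w; rewrite mem_cat => /orP[/Hyc Hp|Hp] Hw.
    exact: leq_trans Hp (Hr_ge _ Hw).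
  exact: Hrx (Hr_ge _ Hw) _ Hp.
Qed.

Lemma avoiding_sortable_blocks s :
  uniq s -> avoiding s -> exists2 t, block_rotation s t & sorted ltn t.
Proof.
have [n] := ubnP (size s); elim: n s => // n IH s Hn Us Hs.
have [->|Hs0] := eqVneq s [::]; first by exists [::]; first constructor.
have [a [c [r [Es Hac Sac Hr]]]] := avoiding_first_block Hs0 Us Hs.
rewrite Es in Hn Us Hs *.
have [||| t Hrt St] := IH r.
- by move: Hn; rewrite size_cat -size_eq0 in Hac *; lia.
- by move: Us; rewrite cat_uniq => /and3P[].
- exact: avoiding_suffix Hs.
exists (rot (size a) (a ++ c) ++ t); first by constructor.
rewrite rot_size_cat sorted_ltn_cat Sac St !andbT.
apply/allrelP => p q Hp Hq; move/allrelP: Hr; apply=> //.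
by rewrite (perm_mem (block_rotation_perm Hrt)).
Qed.

Theorem theorem3p3 (n : nat) (hn : 1 <= n) (pi : seq nat) :
  sortable n pi <->
  Av n [:: [:: 3; 2; 1]; [:: 2; 4; 1; 3]; [:: 3; 1; 4; 2]] pi.
Proof.
rewrite Av_avoiding /sortable reachable_block_rotation.
split=> -[Hperm H]; split=> //.
  exact: block_rotation_avoiding H (iota_ltn_sorted _ _).
have Us : uniq pi by rewrite (perm_uniq Hperm) iota_uniq.
have [t Ht St] := avoiding_sortable_blocks Us H.
suff <- : t = iota 1 n by [].
apply: (irr_sorted_eq ltn_trans ltnn St (iota_ltn_sorted _ _)).
by apply/perm_mem; rewrite -(permPl (block_rotation_perm Ht)).
Qed.
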